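(* Let $G$ be a connected $(\text{claw}, \text{diamond})$-free graph. If $G$ is $N_{1,1,3}$-free, then $G$ contains $K_4$, or $G$ contains $B_{10}$, or $G$ is $3$-colorable.
   Context: All graphs are finite, simple and undirected. For graphs $G$ and $F$, ''$G$ contains $F$'' means that some induced subgraph of $G$ is isomorphic to $F$; $G$ is $(F_1,\dots,F_m)$-free if it contains none of $F_1,\dots,F_m$. The claw is $K_{1,3}$; the diamond is $K_4$ with one edge deleted. For integers $i,j,k\ge 1$, the generalised net $N_{i,j,k}$ is the graph obtained from a triangle $xyz$ and three paths of lengths (numbers of edges) $i$, $j$, $k$, pairwise vertex-disjoint and disjoint from the triangle, by identifying one endvertex of the first path with $x$, one endvertex of the second with $y$, and one endvertex of the third with $z$. The graph $B_{10}$ is the line graph $L(D_7)$, where $D_7$ is the graph obtained from the complete bipartite graph $K_{3,3}$ by subdividing one edge once ($D_7$ has 7 vertices and 10 edges). A graph is $3$-colorable if it admits a proper vertex coloring with at most $3$ colors. *)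

(* Defs.v *)
From mathcomp Require Import all_boot.

Set Implicit Arguments.
Unset Strict Implicit.
Unset Printing Implicit Defensive.

Record sgraph := SGraph {
  vertex :> finType;
  adj : rel vertex;
  adj_sym : symmetric adj;
  adj_irrefl : irreflexive adj
}.

Arguments SGraph : clear implicits.
Arguments adj {s}.

Definition isomorphic (G H : sgraph) : Prop :=
  exists2 f : G -> H, bijective f & forall x y : G, adj (f x) (f y) = adj x y.

Section Induced.
Variables (G : sgraph) (S : {set G}).

Definition induced_vertex : finType := {x : G | x \in S}.
Definition induced_adj : rel induced_vertex := [rel u v | adj (val u) (val v)].

Lemma induced_adj_sym : symmetric induced_adj.
Proof. by move=> u v; apply: adj_sym. Qed.

Lemma induced_adj_irrefl : irreflexive induced_adj.
Proof. by move=> u; apply: adj_irrefl. Qed.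

Definition induced : sgraph :=
  SGraph induced_vertex induced_adj induced_adj_sym induced_adj_irrefl.

End Induced.

Definition contains (G F : sgraph) : Prop :=
  exists S : {set G}, isomorphic (induced S) F.

Definition free (F G : sgraph) : Prop := ~ contains G F.

(* The graph with no vertex counts as connected. *)
Definition connected (G : sgraph) : Prop :=
  forall x y : G, connect (@adj G) x y.

Definition colorable (k : nat) (G : sgraph) : Prop :=
  exists c : G -> 'I_k, forall x y : G, adj x y -> c x != c y.

Section Complete.
Variable n : nat.

Definition complete_adj : rel 'I_n := [rel x y | x != y].

Lemma complete_adj_sym : symmetric complete_adj.
Proof. by move=> x y; rewrite /complete_adj /= eq_sym. Qed.

Lemma complete_adj_irrefl : irreflexive complete_adj.
Proof. by move=> x; rewrite /complete_adj /= eqxx. Qed.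

Definition complete : sgraph :=
  SGraph 'I_n complete_adj complete_adj_sym complete_adj_irrefl.

End Complete.

Section CompleteBipartite.
Variables m n : nat.

Definition bipartite_adj : rel ('I_m + 'I_n) :=
  fun u v => match u, v with
             | inl _, inr _ | inr _, inl _ => true
             | _, _ => false
             end.

Lemma bipartite_adj_sym : symmetric bipartite_adj.
Proof. by case=> ? [] ?. Qed.

Lemma bipartite_adj_irrefl : irreflexive bipartite_adj.
Proof. by case. Qed.

Definition complete_bipartite : sgraph :=
  SGraph ('I_m + 'I_n)%type
    bipartite_adj bipartite_adj_sym bipartite_adj_irrefl.

End CompleteBipartite.

Section DeleteEdge.
Variables (G : sgraph) (a b : G).

Definition del_edge_adj : rel G :=
  [rel x y | adj x y && ([set x; y] != [set a; b])].

Lemma del_edge_adj_sym : symmetric del_edge_adj.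
Proof. by move=> x y; rewrite /del_edge_adj /= adj_sym setUC. Qed.

Lemma del_edge_adj_irrefl : irreflexive del_edge_adj.
Proof. by move=> x; rewrite /del_edge_adj /= adj_irrefl. Qed.

Definition del_edge : sgraph :=
  SGraph G del_edge_adj del_edge_adj_sym del_edge_adj_irrefl.

End DeleteEdge.

(* Subdivision of the edge ab of G; None is the new vertex.  This is only
   meaningful when a and b are adjacent. *)
Section Subdivide.
Variables (G : sgraph) (a b : G).

Definition subdivide_adj : rel (option G) :=
  fun u v => match u, v with
             | Some x, Some y => @adj (del_edge a b) x y
             | Some x, None | None, Some x => x \in [set a; b]
             | None, None => false
             end.

Lemma subdivide_adj_sym : symmetric subdivide_adj.
Proof. by move=> [x|] [y|] //; apply: del_edge_adj_sym. Qed.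

Lemma subdivide_adj_irrefl : irreflexive subdivide_adj.
Proof. by move=> [x|] //; apply: del_edge_adj_irrefl. Qed.

Definition subdivide : sgraph :=
  SGraph (option G) subdivide_adj subdivide_adj_sym subdivide_adj_irrefl.

End Subdivide.

Section LineGraph.
Variable G : sgraph.

Definition edges : {set {set G}} :=
  [set e | [exists x : G, exists y : G, adj x y && (e == [set x; y])]].

Definition line_vertex : finType := {e : {set G} | e \in edges}.

Definition line_adj : rel line_vertex :=
  [rel e f | (e != f) && (val e :&: val f != set0)].

Lemma line_adj_sym : symmetric line_adj.
Proof. by move=> e f; rewrite /line_adj /= eq_sym setIC. Qed.

Lemma line_adj_irrefl : irreflexive line_adj.
Proof. by move=> e; rewrite /line_adj /= eqxx. Qed.

Definition line_graph : sgraph :=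
  SGraph line_vertex line_adj line_adj_sym line_adj_irrefl.

End LineGraph.

(* The vertex Tagged _ p with tag t is the p-th vertex of the t-th path, which
   has length i, j or k; its 0-th vertex is identified with a vertex of the
   triangle. *)
Section GeneralisedNet.
Variables i j k : nat.

Definition net_vertex : finType :=
  {t : 'I_3 & 'I_(nth 0 [:: i; j; k] t).+1}.

Definition net_adj : rel net_vertex :=
  fun u v =>
    let p : nat := tagged u in
    let q : nat := tagged v in
    if tag u == tag v then (p.+1 == q) || (q.+1 == p)
    else (p == 0) && (q == 0).

Lemma net_adj_sym : symmetric net_adj.
Proof. by move=> u v; rewrite /net_adj eq_sym orbC andbC. Qed.

Lemma net_adj_irrefl : irreflexive net_adj.
Proof. by move=> u; rewrite /net_adj eqxx orbb gtn_eqF. Qed.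

Definition generalised_net : sgraph :=
  SGraph net_vertex net_adj net_adj_sym net_adj_irrefl.

End GeneralisedNet.

Definition claw : sgraph := complete_bipartite 1 3.

Definition diamond : sgraph :=
  del_edge (ord0 : complete 4) (ord_max : complete 4).

Definition D7 : sgraph :=
  subdivide (inl ord0 : complete_bipartite 3 3)
            (inr ord0 : complete_bipartite 3 3).

Definition B10 : sgraph := line_graph D7.

(* Main.v *)
Require Import Defs.
From mathcomp Require Import all_boot.

Set Implicit Arguments.
Unset Strict Implicit.
Unset Printing Implicit Defensive.

(* Let G be vertex-critical: not 3-colourable, although each proper induced
   subgraph is.  Its vertices have degree at least 3, so if G has no claw,
   diamond or K_4 then each vertex lies in exactly two maximal cliques, and G is
   the line graph of its clique graph H.  This H is triangle-free with degrees 2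
   and 3, its vertices of degree 2 are pairwise non-adjacent, and no two of them
   have the same neighbours: in the 4-cycle so obtained, the colours of the four
   edges can be chosen last.  If G has no N_{1,1,3}, then H has no spider
   S_{2,2,4} as a (not necessarily induced) subgraph.  Building H up from one
   vertex under these restrictions is a finite process, and each component that
   it can produce either is 3-edge-colourable, which contradicts criticality,
   or contains D_7, which gives B_10 in G. *)

(* The search works on graphs on an initial segment of nat, given by adjacency
   lists.  A pattern lists the edges of each vertex to the earlier ones only. *)

Definition nbrs (a : seq (seq nat)) (i : nat) : seq nat := nth [::] a i.

Fixpoint find_some (A : Type) (F : nat -> option A) (s : seq nat) : option A :=
  if s is x :: s' then
    if F x is Some y then Some y else find_some F s'
  else None.

(* The results of embed and find_colouring are checked afterwards, so that nothing
   has to be proved about these two functions. *)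
Fixpoint embed (p a : seq (seq nat)) (phi : seq nat) : option (seq nat) :=
  if p is js :: p' then
    find_some (fun v =>
      if (v \notin phi) && all (fun j => v \in nbrs a (nth 0 phi j)) (behead js)
      then embed p' a (rcons phi v) else None)
      (if js is j :: _ then nbrs a (nth 0 phi j) else iota 0 (size a))
  else Some phi.

Definition occurs (p a : seq (seq nat)) : bool :=
  if size a < size p then false else
  if embed p a [::] is Some phi then
    [&& uniq phi, size phi == size p, all (gtn (size a)) phi &
      all (fun i => all (fun j => nth 0 phi i \in nbrs a (nth 0 phi j)) (nbrs p i))
        (iota 0 (size p))]
  else false.

(** The spider S_{2,2,4} with centre 0 and legs 1-4, 2-5 and 3-6-7-8; its line graph is
    N_{1,1,3}. *)
Definition spider : seq (seq nat) :=
  [:: [::]; [:: 0]; [:: 0]; [:: 0]; [:: 1]; [:: 2]; [:: 3]; [:: 6]; [:: 7]].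

(** D_7 with sides 0, 1, 2 and 3, 4, 5, where vertex 6 subdivides the edge between 0 and 3. *)
Definition d7 : seq (seq nat) :=
  [:: [::]; [::]; [::]; [:: 1; 2]; [:: 0; 1; 2]; [:: 0; 1; 2]; [:: 0; 3]].

(* An edge colouring is a list of triples (i, j, colour). *)
Definition colour (c : seq (nat * nat * nat)) (i j : nat) : nat :=
  (nth (0, 0, 0) c (find (fun t => (t.1 == (i, j)) || (t.1 == (j, i))) c)).2.

Fixpoint find_colouring (es : seq (nat * nat)) (c : seq (nat * nat * nat)) :
    option (seq (nat * nat * nat)) :=
  if es is (i, j) :: es' then
    find_some (fun x =>
      if has (fun t => (t.2 == x) && has (mem [:: i; j]) [:: t.1.1; t.1.2]) c
      then None else find_colouring es' ((i, j, x) :: c)) [:: 0; 1; 2]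
  else Some c.

Definition edge_colourable (a : seq (seq nat)) : bool :=
  let es := [seq (i, j) | i <- iota 0 (size a), j <- nbrs a i] in
  if find_colouring [seq e <- es | e.1 < e.2] [::] is Some c then
    all (fun i =>
      all (fun j => (colour c i j < 3) &&
          all (fun k => (j == k) || (colour c i j != colour c i k)) (nbrs a i))
        (nbrs a i)) (iota 0 (size a))
  else false.

(** The value [w = size a] is allowed and creates a new vertex. *)
Definition add_edge (v w : nat) (a : seq (seq nat)) : seq (seq nat) :=
  mkseq (fun i => if i == v then w :: nbrs a i
                  else if i == w then v :: nbrs a i else nbrs a i)
    (maxn (size a) w.+1).

(* The vertices in d are those decided to have degree exactly 2.  The fuel k bounds
   the depth; running out of it yields false.  The conditionals are not written
   with || because vm_compute would evaluate both sides of it. *)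
Fixpoint search (k : nat) (d : seq nat) (a : seq (seq nat)) : bool :=
  if k is k'.+1 then
    if occurs spider a then true else
    if [seq v <- iota 0 (size a) | (size (nbrs a v) < 3) && (v \notin d)]
      is v :: _ then
      let s := nbrs a v in
      [&& if size s == 2 then
             if has (mem d) s then true else
             if has (fun w => perm_eq (nbrs a w) s) d then true
             else search k' (v :: d) a
          else true &
        all (fun w => if [|| w == v, w \in s, w \in d, 2 < size (nbrs a w)
                  | has (mem s) (nbrs a w)]
                  then true else search k' d (add_edge v w a))
          (iota 0 (size a).+1)]
    else if edge_colourable a then true else occurs d7 a
  else false.

Definition neighbours (G : sgraph) (x : G) : {set G} := [set y | adj x y].

(** Each level of a branch adds an edge or fixes a degree at 2; 30 levels are enough for every
    branch. *)
Lemma search_succeeds : exists k, search k [::] [:: [::]].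
Proof. by exists 30; vm_compute. Qed.

(** * Soundness of the search in a graph [H] *)

Section Soundness.
Variable H : sgraph.

(** A copy of [p] as a subgraph, not necessarily induced. *)
Definition realises (p : seq (seq nat)) (g : nat -> H) : Prop :=
  {in gtn (size p) &, injective g} /\
  forall i j, j \in nbrs p i -> adj (g i) (g j).

(** [a] is the explored part of [H]. A vertex in [d] has no unexplored neighbour, since both counts
    are 2. *)
Definition models (d : seq nat) (a : seq (seq nat)) (f : nat -> H) : Prop :=
  [/\ realises a f,
      forall i, uniq (nbrs a i),
      forall i j, (j \in nbrs a i) = (i \in nbrs a j) &
      forall i, i \in d -> size (nbrs a i) = 2 /\ #|neighbours (f i)| = 2].

Lemma nbrs_bound a i j : j \in nbrs a i -> i < size a.
Proof. by case: ltnP => // ai; rewrite /nbrs nth_default. Qed.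

Lemma occurs_realises p a f :
  occurs p a -> realises a f -> exists g, realises p g.
Proof.
rewrite /occurs; case: ltnP => // _; case: (embed _ _ _) => // phi.
case/and4P=> phi_uniq /eqP phi_size /allP phi_bound /allP phi_adj [f_inj f_adj].
have phi_lt i : i < size p -> nth 0 phi i < size a.
  by move=> ip; apply: phi_bound; rewrite mem_nth ?phi_size.
exists (fun i => f (nth 0 phi i)); split=> [i j|i j pij].
  rewrite !inE => ip jp /f_inj/eqP; rewrite !inE !phi_lt // => /(_ isT isT).
  by rewrite nth_uniq ?phi_size // => /eqP.
have ip := nbrs_bound pij.
have /allP/(_ j pij) := phi_adj i (etrans (mem_iota 0 _ i) ip).
by rewrite adj_sym; apply: f_adj.
Qed.

(** The listed neighbours are mapped to distinct neighbours of [f i], so they exhaust them once the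
    degree is no larger than the list. *)
Lemma neighbours_full d a f i y : models d a f ->
  #|neighbours (f i)| <= size (nbrs a i) -> adj (f i) y ->
  exists2 j, j \in nbrs a i & y = f j.
Proof.
case=> [[f_inj f_adj] a_uniq a_sym _] deg_le fiy.
have inj_i : {in nbrs a i &, injective f}.
  move=> j k; rewrite !(a_sym i) => /nbrs_bound ja /nbrs_bound ka.
  exact: f_inj.
have sub : {subset map f (nbrs a i) <= enum (neighbours (f i))}.
  by move=> z /mapP[j ij ->]; rewrite mem_enum inE f_adj.
have f_uniq : uniq (map f (nbrs a i)) by rewrite map_inj_in_uniq.
have [|_ eq_nb] := uniq_min_size f_uniq sub; first by rewrite size_map -cardE.
have : y \in map f (nbrs a i) by rewrite eq_nb mem_enum inE.
by case/mapP=> j; exists j.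
Qed.

(** When [y] is not explored yet, [index] returns [size a], which is the name of the next new
    vertex; [g] differs from [f] at most there. *)
Lemma models_add_edge d a f v y : models d a f ->
    v < size a -> v \notin d -> adj (f v) y -> y \notin map f (nbrs a v) ->
  let w := index y (map f (iota 0 (size a))) in
  [/\ w <= size a, w < size a -> y = f w &
      exists g, [/\ {in gtn (size a), g =1 f}, g w = y &
                    w \notin d -> models d (add_edge v w a) g]].
Proof.
move=> mod_f va vd fvy ynb w.
have [[f_inj f_adj] a_uniq a_sym deg_d] := mod_f.
have w_le : w <= size a.
  by rewrite /w -[X in _ <= X](size_iota 0) -(size_map f) index_size.
have yw : w < size a -> y = f w.
  move=> wa; have ys : y \in map f (iota 0 (size a)).
    by rewrite -index_mem size_map size_iota.
  by rewrite -[LHS](nth_index (f 0) ys) (nth_map 0) ?size_iota // nth_iota.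
have y_only i : i < size a -> y = f i -> w = i.
  move=> ia yE; have wa : w < size a.
    rewrite /w -[X in _ < X](size_iota 0) -(size_map f) index_mem yE.
    by apply/mapP; exists i; rewrite ?mem_iota.
  by apply: f_inj; rewrite ?inE // -yw.
pose g i := if i == w then y else f i.
split=> //; exists g.
have gf : {in gtn (size a), g =1 f}.
  by move=> i; rewrite inE /g; case: eqP => // -> wa; rewrite yw.
have gw : g w = y by rewrite /g eqxx.
split=> // wd.
have a'E i : nbrs (add_edge v w a) i =
    if i == v then w :: nbrs a i else if i == w then v :: nbrs a i else nbrs a i.
  case: (ltnP i (maxn (size a) w.+1)) => [?|]; first by rewrite {1}/nbrs nth_mkseq.
  move=> le_i; rewrite {1}/nbrs nth_default ?size_mkseq //.
  move: le_i; rewrite geq_max => /andP[ai wi].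
  rewrite (gtn_eqF (leq_trans va ai)) (gtn_eqF wi) /nbrs.
  by rewrite nth_default.
have wv : w \notin nbrs a v.
  apply: contra ynb => wv; rewrite yw ?map_f //.
  by move: wv; rewrite a_sym => /nbrs_bound.
have vnw : v \notin nbrs a w by rewrite a_sym.
have gadj i j : j \in nbrs a i -> adj (g i) (g j).
  move=> ij; rewrite !gf ?f_adj // inE ?(nbrs_bound ij) //.
  by move: ij; rewrite a_sym => /nbrs_bound.
split; first split.
- move=> i j; rewrite !inE size_mkseq !leq_max !ltnS.
  have aux k : (k < size a) || (k <= w) -> k = w \/ k < size a.
    case/orP=> [|]; first by right.
    by rewrite leq_eqVlt => /orP[/eqP|/leq_trans-> //]; [left | right].
  move=> /aux[->|ia] /aux[->|ja] //.
  + by rewrite gw (gf j) ?inE //; apply: y_only.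
  + by rewrite gw (gf i) ?inE // => /esym/(y_only _ ia)/esym.
  + by rewrite !gf ?inE //; apply: f_inj; rewrite inE.
- move=> i j; rewrite a'E; case: eqP => [->|_].
    rewrite inE => /predU1P[->|]; last exact: gadj.
    by rewrite gw gf ?inE.
  case: eqP => [->|_]; last exact: gadj.
  rewrite inE => /predU1P[->|]; last exact: gadj.
  by rewrite gw gf ?inE // adj_sym.
- by move=> i; rewrite a'E; case: eqP => [->|_]; [|case: eqP => [->|_]];
    rewrite /= ?a_uniq ?wv ?vnw.
- move=> i j; rewrite !a'E; case: (eqVneq i v) (eqVneq j v) => [->|iv] [->|jv] //.
  + by case: (eqVneq j w) => [->|jw]; rewrite !inE ?eqxx // (negbTE jw) a_sym.
  + by case: (eqVneq i w) => [->|iw]; rewrite !inE ?eqxx // (negbTE iw) a_sym.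
  case: (eqVneq i w) (eqVneq j w) => [->|iw] [->|jw] //.
  + by rewrite inE (negbTE jv) a_sym.
  + by rewrite inE (negbTE iv) a_sym.
- move=> i id; have [sz deg] := deg_d i id.
  rewrite a'E; case: eqP => [iv|_]; first by rewrite iv (negbTE vd) in id.
  case: eqP => [iw|_]; first by rewrite iw (negbTE wd) in id.
  rewrite gf // inE; case: (ltnP i (size a)) => // ia.
  by move: sz; rewrite /nbrs nth_default.
Qed.

(** [X] may be any union of components of [H]. *)
Definition edge_coloured_component (X : {set H}) (c : H -> H -> 'I_3) : Prop :=
  [/\ forall x y, x \in X -> adj x y -> y \in X,
      forall x y, c x y = c y x &
      forall x y z, x \in X -> adj x y -> adj x z -> y != z -> c x y != c x z].

(** Once every neighbour of an explored vertex is explored, the image of [f] is closed under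
    adjacency, and the computed colouring is transported along [f]. *)
Lemma edge_colourable_sound d a f : models d a f -> edge_colourable a ->
    {in iota 0 (size a), forall v, #|neighbours (f v)| <= size (nbrs a v)} ->
  exists X c, edge_coloured_component X c /\ {in gtn (size a), forall v, f v \in X}.
Proof.
move=> mod_f; rewrite /edge_colourable; case: (find_colouring _ _) => // c.
move=> /allP c_ok full.
have [[f_inj f_adj] a_uniq a_sym deg_d] := mod_f.
pose X := [set x in map f (iota 0 (size a))].
pose num x := index x (map f (iota 0 (size a))).
have numK i : i < size a -> num (f i) = i.
  move=> ia; rewrite /num.
  have -> : f i = nth (f 0) (map f (iota 0 (size a))) i.
    by rewrite (nth_map 0) ?size_iota // nth_iota.
  rewrite index_uniq ?size_map ?size_iota // map_inj_in_uniq ?iota_uniq //.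
  by move=> x y; rewrite !mem_iota; apply: f_inj.
have inX i : i < size a -> f i \in X.
  by move=> ia; rewrite inE map_f // mem_iota.
have XP x y : x \in X -> adj x y ->
    exists i j, [/\ i < size a, j \in nbrs a i, x = f i & y = f j].
  rewrite inE => /mapP[i]; rewrite mem_iota => ia -> fiy.
  have [|j ij ->] := neighbours_full mod_f _ fiy; last by exists i, j.
  by apply: full; rewrite mem_iota.
exists X, (fun x y => inord (colour c (num x) (num y))); split; last first.
  by move=> v; rewrite inE; apply: inX.
split=> [x y xX xy|x y|x y z xX xy xz].
- have [i [j [ia ij _ ->]]] := XP x y xX xy.
  by move: ij; rewrite a_sym => /nbrs_bound; apply: inX.
- by rewrite /colour; do 3 f_equal; apply: eq_find => t; rewrite orbC.
have [i [j [ia ij xE yE]]] := XP x y xX xy.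
have [i' [k [ia' ik xE' zE]]] := XP x z xX xz.
have ii : i = i' by apply: f_inj; rewrite ?inE -?xE.
rewrite -{}ii in ik xE' => yz.
have jk : j != k by apply: contra yz => /eqP jk; rewrite yE zE jk.
have ja : j < size a by move: ij; rewrite a_sym => /nbrs_bound.
have ka : k < size a by move: ik; rewrite a_sym => /nbrs_bound.
have := c_ok i (etrans (mem_iota 0 _ i) ia) => /allP ci.
have /andP[cj /allP/(_ k ik)] := ci j ij; rewrite (negbTE jk) /= => cjk.
have /andP[ck _] := ci k ik.
rewrite xE yE zE !numK //; apply: contra cjk => /eqP/(congr1 val).
by rewrite /= !inordK // => ->.
Qed.

Hypothesis degree_bounds : forall x : H, 1 < #|neighbours x| <= 3.
Hypothesis triangle_free : forall x y z : H, adj x y -> adj x z -> ~~ adj y z.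
Hypothesis degree2_independent : forall x y : H,
  adj x y -> #|neighbours x| = 2 -> #|neighbours y| <> 2.
Hypothesis degree2_twin_free : forall x y : H,
  #|neighbours x| = 2 -> neighbours x = neighbours y -> x = y.
Hypothesis spider_free : forall g, ~ realises spider g.

(** Induction on the fuel, following the branch that agrees with [H]: the chosen vertex [v] either
    has only its listed neighbours, hence degree 2, or has a further neighbour [y], of index [w]. A
    branch skipped by the search would contradict the hypotheses on [H] or the choice of [y]. *)
Lemma search_sound k d a f : 0 < size a -> search k d a -> models d a f ->
  (exists g, realises d7 g) \/
  exists X c, edge_coloured_component X c /\ X != set0.
Proof.
elim: k d a f => // k IHk d a f a_gt0; cbn [search].
case: ifP => [spd _ [rf _ _ _]|_].
  by have [g /spider_free] := occurs_realises spd rf.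
case E: [seq v <- _ | _] => [|v vs].
  (* No vertex is open any more: each has three listed neighbours or lies in [d], so none of its
     neighbours is missing. *)
  have full : {in iota 0 (size a), forall v, (2 < size (nbrs a v)) || (v \in d)}.
    move=> v va; have : v \notin [::] by [].
    by rewrite -E mem_filter va andbT; case: ltnP => //= _; rewrite negbK.
  case: ifP => [col _ mod_f|_ occ [rf _ _ _]]; last first.
    by left; apply: occurs_realises occ rf.
  right; have [v /full/orP[sz|vd]|X [c [Xc Xf]]] := edge_colourable_sound mod_f col.
  - by apply: leq_trans sz; case/andP: (degree_bounds (f v)).
  - by have [_ _ _ /(_ v vd)[-> ->]] := mod_f.
  exists X, c; split=> //; apply/set0Pn; exists (f 0); exact: Xf.
have : v \in v :: vs by rewrite mem_head.
rewrite -E mem_filter mem_iota add0n => /andP[/andP[sz vd] /andP[_ va]] {E vs}.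
case/andP=> closeP /allP addP mod_f.
have [[f_inj f_adj] a_uniq a_sym deg_d] := mod_f.
have f_sub : {subset map f (nbrs a v) <= enum (neighbours (f v))}.
  by move=> y /mapP[j vj ->]; rewrite mem_enum inE f_adj.
have f_uniq : uniq (map f (nbrs a v)).
  rewrite map_inj_in_uniq // => i j; rewrite !(a_sym v).
  by move=> /nbrs_bound ia /nbrs_bound ja; apply: f_inj.
have [deg_le|deg_gt] := leqP #|neighbours (f v)| (size (nbrs a v)).
  have nbE : map f (nbrs a v) =i neighbours (f v).
    have [|_ eqE y] := uniq_min_size f_uniq f_sub; last by rewrite eqE mem_enum.
    by rewrite size_map -cardE.
  have sz2 : size (nbrs a v) = 2.
    apply/eqP; rewrite eqn_leq -ltnS sz /=.
    by apply: leq_trans deg_le; case/andP: (degree_bounds (f v)).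
  have deg2 : #|neighbours (f v)| = 2.
    apply/eqP; rewrite eqn_leq -{1}sz2 deg_le.
    by case/andP: (degree_bounds (f v)).
  move: closeP; rewrite sz2 eqxx; case: hasP => [[w wv wd] _|_].
    by case: (degree2_independent (f_adj v w wv) deg2); case: (deg_d w wd).
  case: hasP => [[w wd wv] _|_ srch].
    have [szw degw] := deg_d w wd.
    suff /degree2_twin_free : neighbours (f v) = neighbours (f w).
      move=> /(_ deg2)/f_inj wE; case/negP: vd; rewrite wE ?inE //.
      by case: (ltnP w (size a)) => // aw; move: szw; rewrite /nbrs nth_default.
    apply/setP=> y; apply/idP/idP; rewrite -?nbE ?inE.
      case/mapP=> j; rewrite -(perm_mem wv) => wj ->; exact: f_adj.
    move=> wy; have [|j wj ->] := neighbours_full mod_f _ wy.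
      by rewrite szw degw.
    by rewrite map_f // -(perm_mem wv).
  apply: (IHk _ _ f) srch _ => //; split=> // i; rewrite inE.
  by case/predU1P=> [->|/deg_d].
have [y ny yv] : exists2 y, y \in neighbours (f v) & y \notin map f (nbrs a v).
  apply/exists_inP; rewrite -negb_forall_in; apply: contraL deg_gt.
  move=> /forall_inP sub.
  rewrite -leqNgt -(size_map f) cardE; apply: uniq_leq_size (enum_uniq _) _ => y.
  by rewrite mem_enum => /sub.
rewrite inE in ny.
have := models_add_edge mod_f va vd ny yv.
set w := index _ _ => -[w_le yw [g [gf gw mod_g]]].
have {addP} := addP w; rewrite mem_iota ltnS w_le => /(_ isT).
(* The edge from [f w] to [f v] is not listed yet, so an explored [w] can neither lie in [d] nor
   have three listed neighbours. *)
have not_full : w < size a -> size (nbrs a w) < #|neighbours (f w)|.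
  move=> wa; rewrite ltnNge; apply/negP=> deg_le.
  have wv : adj (f w) (f v) by rewrite adj_sym -yw.
  have [j wj /f_inj jE] := neighbours_full mod_f deg_le wv.
  case/negP: yv; rewrite yw // map_f // a_sym jE ?inE //.
  by move: wj; rewrite a_sym => /nbrs_bound.
have size_w m : m < size (nbrs a w) -> w < size a.
  by case: (ltnP w (size a)) => // aw; rewrite /nbrs nth_default.
have wd : w \notin d.
  apply/negP=> wd; have [szw degw] := deg_d w wd.
  by have := not_full (size_w 0 _); rewrite szw degw => /(_ isT).
case: ifP => [|_ srch]; last first.
  apply: IHk srch (mod_g wd); by rewrite size_mkseq leq_max a_gt0.
rewrite (negbTE wd); case: eqP => [wE|_].
  by move: ny; rewrite yw wE // adj_irrefl.
case: (boolP (w \in _)) => [wv _|_] /=.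
  case/negP: yv; rewrite yw ?map_f //.
  by move: wv; rewrite a_sym => /nbrs_bound.
case/orP=> [szw|/hasP[u uw uv]].
  have := not_full (size_w _ szw).
  by rewrite ltnNge (leq_trans _ szw) //; case/andP: (degree_bounds (f w)).
(* [u] is a listed common neighbour of [v] and [w], so the edge to [y] would close a triangle. *)
have wa := nbrs_bound uw.
have := triangle_free ny (f_adj _ _ uv).
by rewrite yw // f_adj.
Qed.

(** The search starts from the single vertex [x0] with no edge explored. *)
Theorem subcubic_search (x0 : H) :
  (exists g, realises d7 g) \/
  exists X c, edge_coloured_component X c /\ X != set0.
Proof.
have [k srch] := search_succeeds.
apply: (search_sound _ srch (f := fun=> x0)) => //; split=> //.
- split=> [i j|i j]; first by rewrite !inE !ltnS !leqn0 => /eqP-> /eqP->.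
  by rewrite /nbrs; case: i => [|[]].
- by case=> [|[]].
- by case=> [|[|i]] [|[|j]].
Qed.

End Soundness.

(** * Induced copies and the forbidden subgraphs *)

Lemma contains_embedding (G F : sgraph) (phi : F -> G) :
  injective phi -> (forall x y, adj (phi x) (phi y) = adj x y) -> contains G F.
Proof.
move=> phi_inj phi_adj; exists (phi @: setT).
have phiP x : phi x \in phi @: setT by rewrite imset_f.
pose g x : induced (phi @: setT) := exist _ (phi x) (phiP x).
have g_inj : injective g by move=> x y /(congr1 val)/phi_inj.
have [|h gK hK] := inj_card_bij g_inj.
  by rewrite card_sig card_imset // cardsT.
exists h => [|u v]; first by exists g.
by rewrite -phi_adj -{2}(hK u) -{2}(hK v).
Qed.

Lemma embedding_contains (G F : sgraph) : contains G F ->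
  exists2 phi : F -> G,
    injective phi & forall x y, adj (phi x) (phi y) = adj x y.
Proof.
case=> S [f [g fK gK] f_adj]; exists (fun x => val (g x)).
  by move=> x y /val_inj/(can_inj gK).
by move=> x y; rewrite -{2}(gK x) -{2}(gK y) f_adj.
Qed.

(** Only finitely many functions from [F] to [G] have to be tested. *)
Lemma contains_decidable (G F : sgraph) : contains G F \/ ~ contains G F.
Proof.
pose embeds (phi : {ffun F -> G}) := injectiveb phi &&
  [forall x, forall y, adj (phi x) (phi y) == adj x y].
case: (pickP embeds) => [phi /andP[/injectiveP phi_inj /forallP phi_adj]|no_phi].
  left; apply: contains_embedding phi_inj _ => x y.
  by have /forallP/(_ y)/eqP := phi_adj x.
right=> /embedding_contains[phi phi_inj phi_adj].
have /negP := negbT (no_phi (finfun phi)); apply; apply/andP; split.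
  by apply/injectiveP=> x y; rewrite !ffunE => /phi_inj.
by apply/forallP=> x; apply/forallP=> y; rewrite !ffunE phi_adj.
Qed.

Lemma contains_induced (G F : sgraph) (S : {set G}) :
  contains (induced S) F -> contains G F.
Proof.
case/embedding_contains=> phi phi_inj phi_adj.
apply: (@contains_embedding G F (fun x => val (phi x))) => [x y|x y].
  by move/val_inj/phi_inj.
by rewrite -phi_adj.
Qed.

Lemma eq_set2 (T : finType) (x y a b : T) :
  ([set x; y] == [set a; b]) = (x == a) && (y == b) || (x == b) && (y == a).
Proof.
apply/eqP/idP => [/setP E|/orP[]/andP[/eqP-> /eqP->] //]; last by rewrite setUC.
move: (E x) (E y) (E a) (E b); rewrite !inE !eqxx ?orbT.
case/esym/orP=> /eqP->; case/esym/orP=> /eqP->; rewrite ?eqxx ?orbT ?orbb //.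
  by move=> _ /eqP->; rewrite eqxx.
by move=> /eqP->; rewrite eqxx.
Qed.

Lemma contains_K4 (G : sgraph) (u v x y : G) :
    adj u v -> adj u x -> adj u y -> adj v x -> adj v y -> adj x y ->
  contains G (complete 4).
Proof.
move=> uv ux uy vx vy xy.
have phi_adj (i j : complete 4) :
    adj (nth u [:: u; v; x; y] i) (nth u [:: u; v; x; y] j) = adj i j.
  case: i => [[|[|[|[|//]]]] ?]; case: j => [[|[|[|[|//]]]] ?];
    rewrite /= /complete_adj /= ?adj_irrefl //; by rewrite adj_sym.
apply: (contains_embedding _ phi_adj) => i j ij.
by apply/eqP/negPn/negP => nij; have := phi_adj i j;
  rewrite ij adj_irrefl /= /complete_adj /= nij.
Qed.

Lemma contains_diamond (G : sgraph) (u v x y : G) :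
    adj u v -> adj u x -> adj u y -> adj v x -> adj v y -> x != y ->
    ~~ adj x y ->
  contains G diamond.
Proof.
move=> uv ux uy vx vy nxy xy.
have adjC (a b : G) : adj a b -> adj b a by rewrite adj_sym.
have nE (a b : G) : adj a b -> a != b.
  by apply: contraTneq => ->; rewrite adj_irrefl.
have yx : ~~ adj y x by rewrite adj_sym.
(* The edge missing from [diamond] joins [ord0] and [ord_max], so [x] and [y] stand first and
   last. *)
pose s := [:: x; u; v; y].
have s_uniq : uniq s.
  rewrite /= !inE !negb_or nxy !nE //; auto.
apply: (@contains_embedding G diamond (fun i : 'I_4 => nth x s i)).
  by move=> i j /eqP; rewrite nth_uniq // => /eqP/val_inj.
move=> i j; rewrite /= /del_edge_adj /= /complete_adj /= eq_set2.
case: i => [[|[|[|[|//]]]] ?]; case: j => [[|[|[|[|//]]]] ?];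
  rewrite /= ?adj_irrefl //; by [rewrite adj_sym | apply/negbTE].
Qed.

Lemma contains_claw (G : sgraph) (v a b c : G) :
    adj v a -> adj v b -> adj v c -> a != b -> a != c -> b != c ->
    ~~ adj a b -> ~~ adj a c -> ~~ adj b c ->
  contains G claw.
Proof.
move=> va vb vc ab ac bc nab nac nbc.
have nE (x y : G) : adj x y -> x != y.
  by apply: contraTneq => ->; rewrite adj_irrefl.
pose s := [:: a; b; c].
have s_uniq : uniq s by rewrite /= !inE !negb_or ab ac bc.
have s_adj i : i < 3 -> adj v (nth a s i) by case: i => [|[|[|]]].
pose phi (x : 'I_1 + 'I_3) := if x is inr i then nth a s i else v.
apply: (@contains_embedding G claw phi).
  move=> [i|i] [j|j] /=; rewrite ?ord1 //.
  - by move=> E; have := s_adj j (ltn_ord j); rewrite -E adj_irrefl.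
  - by move=> E; have := s_adj i (ltn_ord i); rewrite E adj_irrefl.
  - by move=> /eqP; rewrite nth_uniq // => /eqP/val_inj->.
move=> [i|i] [j|j] /=; rewrite ?adj_irrefl ?s_adj //; first by rewrite adj_sym s_adj.
case: i => [[|[|[|//]]] ?]; case: j => [[|[|[|//]]] ?]; rewrite /= ?adj_irrefl //; 
  apply/negbTE => //; by rewrite adj_sym.
Qed.

(** * Three-colourings and vertex-critical graphs *)

Section Colouring.
Variable G : sgraph.

Definition proper_on (c : G -> 'I_3) (A : {set G}) : Prop :=
  {in A &, forall x y, adj x y -> c x != c y}.

Definition vertex_critical : Prop :=
  ~ colorable 3 G /\ forall A : {set G}, A != setT -> exists c, proper_on c A.

Lemma avoid_colours (X : {set 'I_3}) : #|X| < 3 -> exists z, z \notin X.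
Proof.
move=> X3; have : ~: X != set0.
  by rewrite -card_gt0 cardsCs setCK card_ord subn_gt0.
by case/set0Pn=> z; rewrite inE; exists z.
Qed.

Lemma avoid_two_colours (x y : 'I_3) : exists z, z != x /\ z != y.
Proof.
have [|z] := @avoid_colours [set x; y]; first by rewrite cards2; case: (x != y).
by rewrite !inE negb_or => /andP[]; exists z.
Qed.

(** If [v] had at most two neighbours, a colouring of the graph without [v] would leave a colour
    free for [v]. *)
Lemma critical_degree : vertex_critical -> forall v : G, 2 < #|neighbours v|.
Proof.
case=> ncol crit v; rewrite ltnNge; apply/negP=> deg_v.
have [|c c_proper] := crit (~: [set v]).
  by apply/eqP=> /setP/(_ v); rewrite !inE eqxx.
have [|z zP] := @avoid_colours (c @: neighbours v).
  exact: leq_ltn_trans (leq_imset_card _ _) _.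
have zv u : adj v u -> c u != z.
  by move=> vu; apply: contra zP => /eqP <-; rewrite imset_f ?inE.
case: ncol; exists (fun x => if x == v then z else c x) => x y xy.
case: (eqVneq x v) (eqVneq y v) xy => [->|xv] [->|yv] xy.
- by rewrite adj_irrefl in xy.
- by rewrite eq_sym zv.
- by rewrite zv // adj_sym.
by apply: c_proper; rewrite ?inE.
Qed.

End Colouring.

(** * The clique graph of a critical graph *)

Section RootGraph.
Variable G : sgraph.

(** For an edge [u v] of a diamond-free graph this is the unique maximal clique containing it. *)
Definition clique_of (u v : G) : {set G} :=
  [set w | ((w == u) || adj w u) && ((w == v) || adj w v)].

Definition cliques : {set {set G}} :=
  [set clique_of p.1 p.2 | p : G * G & adj p.1 p.2].

Definition root_vertex : finType := {K : {set G} | K \in cliques}.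

Definition root_adj : rel root_vertex :=
  [rel K L | (K != L) && (val K :&: val L != set0)].

Lemma root_adj_sym : symmetric root_adj.
Proof. by move=> K L; rewrite /root_adj /= eq_sym setIC. Qed.

Lemma root_adj_irrefl : irreflexive root_adj.
Proof. by move=> K; rewrite /root_adj /= eqxx. Qed.

Definition root : sgraph :=
  SGraph root_vertex root_adj root_adj_sym root_adj_irrefl.

(** The vertex [v] of [G] is viewed as an edge of [root], joining the cliques that contain it. *)
Definition ends (v : G) : {set root} := [set K : root | v \in val K].

Hypothesis claw_free : free claw G.
Hypothesis diamond_free : free diamond G.
Hypothesis K4_free : free (complete 4) G.
Hypothesis critical : vertex_critical G.

(** Two distinct common neighbours of an edge form with it a K_4 if they are adjacent, and a diamond
    if not. *)
Lemma common_neighbour_uniq (u v x y : G) :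
  adj u v -> adj u x -> adj v x -> adj u y -> adj v y -> x = y.
Proof.
move=> uv ux vx uy vy; apply/eqP/negPn/negP=> xy.
case: (boolP (adj x y)) => [?|nxy].
  by apply: K4_free; apply: (@contains_K4 _ u v x y).
by apply: diamond_free; apply: (@contains_diamond _ u v x y).
Qed.

Lemma clique_of_adj u v x y : adj u v ->
  x \in clique_of u v -> y \in clique_of u v -> x != y -> adj x y.
Proof.
have adjC (a b : G) : adj a b -> adj b a by rewrite adj_sym.
move=> uv; rewrite !inE.
case/andP=> xu xv /andP[yu yv] xy.
case/predU1P: xu => [xu|xu]; first rewrite xu adj_sym.
  by case/predU1P: yu xy => // ->; rewrite xu eqxx.
case/predU1P: xv => [xv|xv]; first rewrite xv adj_sym.
  by case/predU1P: yv xy => // ->; rewrite xv eqxx.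
case/predU1P: yu => [->//|yu]; case/predU1P: yv => [->//|yv].
by case/eqP: xy; apply: (common_neighbour_uniq uv); apply: adjC.
Qed.

Lemma clique_of_eq u v x y : adj u v ->
  x \in clique_of u v -> y \in clique_of u v -> x != y ->
  clique_of u v = clique_of x y.
Proof.
move=> uv xK yK xy; apply/setP=> w; apply/idP/idP=> [wK|].
  rewrite inE; apply/andP; split; case: (eqVneq w _) => //=.
    exact: clique_of_adj uv wK xK.
  exact: clique_of_adj uv wK yK.
have x_adj_y := clique_of_adj uv xK yK xy.
rewrite inE => /andP[/predU1P[->//|wx] /predU1P[->//|wy]].
have claim z : (x == z) || adj x z -> (y == z) || adj y z -> (w == z) || adj w z.
  case/predU1P=> [<-|xz]; first by rewrite wx orbT.
  case/predU1P=> [<-|yz]; first by rewrite wy orbT.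
  apply/predU1P; left.
  by apply: (common_neighbour_uniq x_adj_y) => //; rewrite adj_sym.
move: xK yK; rewrite !inE => /andP[xu xv] /andP[yu yv].
by rewrite !claim.
Qed.

Lemma mem_clique_of u v : adj u v -> (u \in clique_of u v) * (v \in clique_of u v).
Proof. by move=> uv; split; rewrite !inE eqxx 1?(adj_sym v) uv orbT. Qed.

Lemma rootP (K : root) : exists u v, adj u v /\ val K = clique_of u v.
Proof. by have /imsetP[[u v] uv ->] := valP K; exists u, v; rewrite inE in uv. Qed.

Lemma root_clique (K : root) x y :
  x \in val K -> y \in val K -> x != y -> adj x y /\ val K = clique_of x y.
Proof.
have [u [v [uv ->]]] := rootP K => xK yK xy.
by split; [apply: (clique_of_adj uv) | apply: clique_of_eq].
Qed.

Lemma root_other (K : root) x : x \in val K -> exists2 y, y \in val K & adj x y.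
Proof.
have [u [v [uv ->]]] := rootP K => xK; have [uK vK] := mem_clique_of uv.
case: (eqVneq x u) => [->|xu]; first by exists v.
by exists u => //; apply: clique_of_adj uv _ _ xu.
Qed.

Lemma root_uniq (K L : root) x y :
  x \in val K -> y \in val K -> x \in val L -> y \in val L -> x != y -> K = L.
Proof.
move=> xK yK xL yL xy; apply: val_inj.
by rewrite (root_clique xK yK xy).2 (root_clique xL yL xy).2.
Qed.

Lemma root_third (K : root) x y : x \in val K -> y \in val K -> x != y ->
  exists z, val K \subset [set x; y; z].
Proof.
move=> xK yK xy; have [x_adj_y KE] := root_clique xK yK xy.
case: (set_0Vmem (val K :\: [set x; y])) => [K0|[z]].
  exists x; apply/subsetP=> w wK; apply: contraT; rewrite !inE !negb_or.
  by case/andP=> wxy _; have := in_set0 w; rewrite -K0 !inE negb_or wxy wK.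
rewrite !inE negb_or => /andP[/andP[zx zy] zK]; exists z.
apply/subsetP=> w wK; rewrite !inE.
case: (eqVneq w x) (eqVneq w y) => [//|wx] [//|wy] /=.
apply/eqP; apply: (common_neighbour_uniq x_adj_y).
- by have [] := root_clique xK wK; rewrite 1?eq_sym.
- by have [] := root_clique yK wK; rewrite 1?eq_sym.
- by have [] := root_clique xK zK; rewrite 1?eq_sym.
by have [] := root_clique yK zK; rewrite 1?eq_sym.
Qed.

Lemma root_of_edge u v : adj u v -> exists2 K : root, u \in val K & v \in val K.
Proof.
move=> uv; have KP : clique_of u v \in cliques.
  by apply/imsetP; exists (u, v); rewrite ?inE.
by exists (exist (fun K => K \in cliques) _ KP); rewrite /= mem_clique_of.
Qed.

Lemma root_card (K : root) : 1 < #|val K| <= 3.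
Proof.
have [u [v [uv KE]]] := rootP K; have [uK vK] := mem_clique_of uv.
have u_neq_v : u != v by apply: contraTneq uv => ->; rewrite adj_irrefl.
rewrite -KE in uK vK; apply/andP; split; first by apply/card_gt1P; exists u, v.
have [z /subset_leq_card/leq_trans->//] := root_third uK vK u_neq_v.
apply: leq_trans (leq_card_setU _ _) _.
by rewrite cards1 addn1 ltnS cards2; case: (u != v).
Qed.

(** Neighbours of [v] taken from three different cliques would be the leaves of a claw. If there
    were only one clique, its size of at most 3 would give [v] degree at most 2, against
    criticality. *)
Lemma card_ends v : #|ends v| = 2.
Proof.
apply/eqP; rewrite eqn_leq; apply/andP; split.
  rewrite leqNgt; apply/negP=> /card_gt2P[K1 [K2 [K3 [[]]]]].
  rewrite !inE => vK1 vK2 vK3 [K12 K23 K31].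
  have [x1 x1K vx1] := root_other vK1; have [x2 x2K vx2] := root_other vK2.
  have [x3 x3K vx3] := root_other vK3.
  have sep (K L : root) x y : K != L -> v \in val K -> v \in val L ->
      x \in val K -> y \in val L -> adj v x -> adj v y -> x != y /\ ~~ adj x y.
    move=> KL vK vL xK yL vx vy.
    have neq z : adj v z -> v != z.
      by apply: contraTneq => ->; rewrite adj_irrefl.
    have yK : y \notin val K.
      by apply: contra KL => yK; apply/eqP/(root_uniq vK yK vL yL)/neq.
    split; first by apply: contraNneq yK => <-.
    apply: contra yK => xy; rewrite (root_clique vK xK (neq x vx)).2.
    by rewrite inE !(adj_sym y) vy xy !orbT.
  have [x12 n12] := sep _ _ _ _ K12 vK1 vK2 x1K x2K vx1 vx2.
  have [x23 n23] := sep _ _ _ _ K23 vK2 vK3 x2K x3K vx2 vx3.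
  have [x31 n31] := sep _ _ _ _ K31 vK3 vK1 x3K x1K vx3 vx1.
  by apply: claw_free; apply: (@contains_claw _ v x1 x2 x3) => //;
    rewrite 1?eq_sym 1?adj_sym.
rewrite ltnNge; apply/negP=> /card_le1P ends_le1.
have /card_gt0P[x] : 0 < #|neighbours v|.
  exact: leq_trans (critical_degree critical v).
rewrite inE => /root_of_edge[K vK xK].
have := critical_degree critical v; rewrite ltnNge; case/negP.
have : #|neighbours v| < #|val K|.
  apply: proper_card; apply/properP; split; last first.
    by exists v; rewrite // inE adj_irrefl.
  apply/subsetP=> y; rewrite inE => /root_of_edge[L vL yL].
  have := ends_le1 K; rewrite inE => /(_ vK L); rewrite !inE vL.
  by move/esym/eqP <-.
by case/andP: (root_card K) => _ K3 /leq_trans/(_ K3).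
Qed.

(** Two distinct vertices lie in at most one common clique, so [root] needs no parallel edges. *)
Lemma ends_inj : injective ends.
Proof.
move=> u v E; apply/eqP/negPn/negP=> uv.
have /eqP/cards2P[K [L [KL EE]]] := card_ends u.
have KE : K \in ends u by rewrite EE !inE eqxx.
have LE : L \in ends u by rewrite EE !inE eqxx orbT.
have := (KE, LE); rewrite E !inE => -[vK vL]; rewrite !inE in KE LE.
by case/eqP: KL; apply: root_uniq uv.
Qed.

(** Together with [ends_inj] and [root_adjP] this makes [G] the line graph of [root]. *)
Lemma adj_ends u v : adj u v = (u != v) && (ends u :&: ends v != set0).
Proof.
apply/idP/andP=> [uv|[uv /set0Pn[K]]]; last first.
  by rewrite !inE => /andP[uK vK]; have [] := root_clique uK vK uv.
split; first by apply: contraTneq uv => ->; rewrite adj_irrefl.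
have [K uK vK] := root_of_edge uv.
by apply/set0Pn; exists K; rewrite !inE uK.
Qed.

Lemma root_adjP (K L : root) : reflect (exists v, ends v = [set K; L]) (adj K L).
Proof.
apply: (iffP andP) => [[KL /set0Pn[v]]|[v E]].
  rewrite inE => /andP[vK vL]; exists v; apply/esym/eqP.
  by rewrite eqEcard subUset !sub1set !inE vK vL cards2 KL card_ends.
have := card_ends v; rewrite E cards2; case: (eqVneq K L) => // KL _.
split=> //; apply/set0Pn; exists v.
have : K \in ends v by rewrite E !inE eqxx.
have : L \in ends v by rewrite E !inE eqxx orbT.
by rewrite !inE => -> ->.
Qed.

Lemma endsP v (K : root) : v \in val K -> exists2 L, adj K L & ends v = [set K; L].
Proof.
move=> vK; have KE : K \in ends v by rewrite inE.
have /eqP/cards2P[L [M [LM E]]] := card_ends v.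
move: KE; rewrite E !inE => /orP[]/eqP KE; subst.
  by exists M => //; apply/root_adjP; exists v.
by exists L; [apply/root_adjP; exists v; rewrite setUC | rewrite setUC].
Qed.

Lemma mem_ends v (K L : root) : ends v = [set K; L] -> (v \in val K) * (v \in val L).
Proof.
move=> E.
have : K \in ends v by rewrite E !inE eqxx.
have : L \in ends v by rewrite E !inE eqxx orbT.
by rewrite !inE => -> ->.
Qed.

(** Each vertex of the clique [K] is an edge of [root] at [K], and is matched with its other end. *)
Lemma root_degree (K : root) : #|neighbours K| = #|val K|.
Proof.
have inj : {in val K &, injective (fun v => ends v :\ K)}.
  move=> u v uK vK /(congr1 (setU [set K])).
  by rewrite !setD1K ?inE // => /ends_inj.
rewrite -(card_imset _ (@set1_inj _)) -(card_in_imset inj); apply: eq_card => X.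
have D1 (L : root) : adj K L -> [set K; L] :\ K = [set L].
  move=> KL; rewrite setU1K // inE; apply: contraTneq KL => ->.
  by rewrite adj_irrefl.
apply/imsetP/imsetP=> [[L]|[v vK ->]].
  rewrite inE => KL ->; have /root_adjP[v E] := KL; exists v.
    by rewrite (mem_ends E).
  by rewrite E D1.
by have [L KL E] := endsP vK; exists L; rewrite ?inE // E D1.
Qed.

(** The edges of a triangle are three pairwise adjacent vertices of [G]; the one over [L M] would
    then belong to the clique spanned by the other two, which is [K]. *)
Lemma root_triangle_free (K L M : root) : adj K L -> adj K M -> ~~ adj L M.
Proof.
move=> KL KM; apply/negP=> LM.
have neq (P Q : root) : adj P Q -> P != Q.
  by apply: contraTneq => ->; rewrite adj_irrefl.
have := (neq _ _ KL, neq _ _ KM, neq _ _ LM) => -[[nKL nKM] nLM].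
have /root_adjP[u uE] := KL; have /root_adjP[v vE] := KM.
have /root_adjP[w wE] := LM.
have [[[uK uL] [vK vM]] [wL wM]] := (mem_ends uE, mem_ends vE, mem_ends wE).
have uM : u \notin val M.
  have := in_set2 M K L; rewrite -uE inE => ->.
  by rewrite negb_or !(eq_sym M) nKM.
have wK : w \notin val K.
  by have := in_set2 K L M; rewrite -wE inE => ->; rewrite negb_or nKL.
have uv : u != v by apply: contraNneq uM => ->.
have wu : w != u by apply: contraNneq wK => ->.
have wv : w != v by apply: contraNneq wK => ->.
case/negP: wK; rewrite (root_clique uK vK uv).2 inE.
by rewrite (root_clique wL uL wu).1 (root_clique wM vM wv).1 !orbT.
Qed.

(** The vertex of [G] joining [K] and [L] would have at most one neighbour in each of these two
    cliques, against [critical_degree]. *)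
Lemma root_degree2_independent (K L : root) :
  adj K L -> #|neighbours K| = 2 -> #|neighbours L| <> 2.
Proof.
rewrite !root_degree => /root_adjP[v E] K2 L2; have [vK vL] := mem_ends E.
have := critical_degree critical v; rewrite ltnNge; case/negP.
apply: (@leq_trans #|(val K :\ v) :|: (val L :\ v)|); last first.
  apply: leq_trans (leq_card_setU _ _) _.
  have card1 (M : root) : v \in val M -> #|val M| = 2 -> #|val M :\ v| = 1.
    by move=> vM M2; apply/eqP; rewrite -eqSS -M2 (cardsD1 v (val M)) vM.
  by rewrite !card1.
apply/subset_leq_card/subsetP=> x; rewrite inE => vx.
have xv : x != v by apply: contraTneq vx => ->; rewrite adj_irrefl.
have [M vM xM] := root_of_edge vx; rewrite !inE xv /=.
have : M \in ends v by rewrite inE.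
by rewrite E !inE => /orP[]/eqP <-; rewrite xM ?orbT.
Qed.

(** Otherwise [K], [L], [K'], [M] form a 4-cycle. Its edges are the vertices [p], [r], [s], [q] of
    [G], and a colouring of the rest of [G] extends to them. *)
Lemma root_degree2_twin_free (K K' : root) :
  #|neighbours K| = 2 -> neighbours K = neighbours K' -> K = K'.
Proof.
move=> K2 KK'; apply/eqP/negPn/negP=> nKK'.
have /eqP/cards2P[L [M [LM KE]]] := K2.
have [KL KM] : adj K L /\ adj K M.
  have := (in_set2 L L M, in_set2 M L M).
  by rewrite -KE !inE !eqxx orbT => -[].
have [K'L K'M] : adj K' L /\ adj K' M.
  have := (in_set2 L L M, in_set2 M L M).
  by rewrite -KE KK' !inE !eqxx orbT => -[].
have /root_adjP[p pE] := KL; have /root_adjP[q qE] := KM.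
have /root_adjP[r rE] := K'L; have /root_adjP[s sE] := K'M.
have neq (P Q : root) : adj P Q -> P != Q.
  by apply: contraTneq => ->; rewrite adj_irrefl.
have [[nKL nKM] [nK'L nK'M]] :=
  ((neq _ _ KL, neq _ _ KM), (neq _ _ K'L, neq _ _ K'M)).
have [[pK pL] [qK qM]] := (mem_ends pE, mem_ends qE).
have [[rK' rL] [sK' sM]] := (mem_ends rE, mem_ends sE).
have pM : p \notin val M.
  have := in_set2 M K L; rewrite -pE inE => ->.
  by rewrite negb_or !(eq_sym M) nKM.
have rM : r \notin val M.
  have := in_set2 M K' L; rewrite -rE inE => ->.
  by rewrite negb_or !(eq_sym M) nK'M.
have qL : q \notin val L.
  have := in_set2 L K M; rewrite -qE inE => ->.
  by rewrite negb_or eq_sym nKL.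
have sL : s \notin val L.
  have := in_set2 L K' M; rewrite -sE inE => ->.
  by rewrite negb_or eq_sym nK'L.
have rK : r \notin val K.
  have := in_set2 K K' L; rewrite -rE inE => ->.
  by rewrite negb_or nKK'.
have sK : s \notin val K.
  have := in_set2 K K' M; rewrite -sE inE => ->.
  by rewrite negb_or nKK'.
have pq : p != q by apply: contraNneq pM => ->.
have rs : r != s by apply: contraNneq rM => ->.
have pr : p != r by apply: contraNneq rK => <-.
have ps : p != s by apply: contraNneq sK => <-.
have qr : q != r by apply: contraNneq rK => <-.
have qs : q != s by apply: contraNneq sK => <-.
have valK : val K = [set p; q].
  apply/esym/eqP; rewrite eqEcard subUset !sub1set pK qK -root_degree K2.
  by rewrite cards2 pq.
have valK' : val K' = [set r; s].
  apply/esym/eqP; rewrite eqEcard subUset !sub1set rK' sK' -root_degree -KK' K2.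
  by rewrite cards2 rs.
(* [tL] and [tM] are the only possible further members of [L] and [M]. If there is none, they may be
   arbitrary, and avoiding their colours does no harm. *)
have [tL /subsetP subL] := root_third pL rL pr.
have [tM /subsetP subM] := root_third qM sM qs.
have [|c c_proper] := critical.2 (~: [set p; q; r; s]).
  by apply/eqP=> /setP/(_ p); rewrite !inE eqxx.
(* p and s are not adjacent, so they can share a colour z that is missing at tL
   and tM; then q and r each see only two colours. *)
have [z [zL zM]] := avoid_two_colours (c tL) (c tM).
have [cr [crL crz]] := avoid_two_colours (c tL) z.
have [cq [cqM cqz]] := avoid_two_colours (c tM) z.
pose c' v := if (v == p) || (v == s) then z else if v == q then cq
  else if v == r then cr else c v.
have c'p : c' p = z by rewrite /c' eqxx.
have c's : c' s = z by rewrite /c' eqxx orbT.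
have c'q : c' q = cq by rewrite /c' eqxx eq_sym (negbTE pq) (negbTE qs).
have c'r : c' r = cr.
  by rewrite /c' eqxx eq_sym (negbTE pr) (negbTE rs) eq_sym (negbTE qr).
have c'E w : w \notin [set p; q; r; s] -> c' w = c w.
  rewrite !inE !negb_or /c'.
  by case/andP=> /andP[/andP[/negbTE-> /negbTE->] /negbTE->] /negbTE->.
have inL w : w \in val L -> [\/ w = p, w = r | c' w = c tL].
  move=> wL; move: (subL w wL); rewrite !inE.
  case: (eqVneq w p) => [->|wp]; first by constructor 1.
  case: (eqVneq w r) => [->|wr]; first by constructor 2.
  move=> /= /eqP wt; constructor 3; rewrite -wt; apply: c'E.
  rewrite !inE (negbTE wp) (negbTE wr) /= orbF negb_or.
  by apply/andP; split; apply: contraTneq wL => ->.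
have inM w : w \in val M -> [\/ w = q, w = s | c' w = c tM].
  move=> wM; move: (subM w wM); rewrite !inE.
  case: (eqVneq w q) => [->|wq]; first by constructor 1.
  case: (eqVneq w s) => [->|ws]; first by constructor 2.
  move=> /= /eqP wt; constructor 3; rewrite -wt; apply: c'E.
  rewrite !inE (negbTE wq) (negbTE ws) /= !orbF negb_or.
  by apply/andP; split; apply: contraTneq wM => ->.
have inK w : w \in val K -> w = p \/ w = q.
  by rewrite valK !inE => /orP[]/eqP; [left | right].
have inK' w : w \in val K' -> w = r \/ w = s.
  by rewrite valK' !inE => /orP[]/eqP; [left | right].
have adj_neq (x y : G) : adj x y -> x <> y.
  by move=> xy E; move: xy; rewrite E adj_irrefl.
have step v P Q w : ends v = [set P; Q] -> adj v w -> w \in val P \/ w \in val Q.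
  move=> vE /root_of_edge[R vR wR]; have : R \in ends v by rewrite inE.
  by rewrite vE !inE => /orP[]/eqP <-; [left | right].
have zq : z != cq by rewrite eq_sym.
have zr : z != cr by rewrite eq_sym.
have local v w : v \in [set p; q; r; s] -> adj v w -> c' v != c' w.
  rewrite !inE => /orP[/orP[/orP[]|]|] /eqP-> vw; have nvw := adj_neq _ _ vw.
  - by case: (step p _ _ w pE vw) => [/inK[]|/inL[]] wE;
      rewrite ?c'p wE ?c'q ?c'r // in nvw *.
  - by case: (step q _ _ w qE vw) => [/inK[]|/inM[]] wE;
      rewrite ?c'q wE ?c'p ?c's // in nvw *.
  - by case: (step r _ _ w rE vw) => [/inK'[]|/inL[]] wE;
      rewrite ?c'r wE ?c'p ?c's // in nvw *.
  - by case: (step s _ _ w sE vw) => [/inK'[]|/inM[]] wE;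
      rewrite ?c's wE ?c'q ?c'r // in nvw *.
case: critical => ncol _; case: ncol; exists c' => x y xy.
case: (boolP (x \in [set p; q; r; s])) => xS; first exact: local.
case: (boolP (y \in [set p; q; r; s])) => yS.
  by rewrite eq_sym; apply: local; rewrite // adj_sym.
by rewrite !c'E //; apply: c_proper; rewrite // inE.
Qed.

(** * From subgraphs and edge colourings of the clique graph back to [G] *)

Lemma line_embedding (F : sgraph) (E : F -> {set root}) :
    (forall x, exists K L, adj K L /\ E x = [set K; L]) -> injective E ->
    (forall x y, adj x y = (x != y) && (E x :&: E y != set0)) ->
  contains G F.
Proof.
move=> E_edge E_inj E_adj.
have E_ends x : exists v, ends v == E x.
  by have [K [L [/root_adjP[v vE] ->]]] := E_edge x; exists v; apply/eqP.
pose phi x := xchoose (E_ends x).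
have phiE x : ends (phi x) = E x by apply/eqP/(xchooseP (E_ends x)).
have phi_inj : injective phi.
  by move=> x y /(congr1 ends); rewrite !phiE => /E_inj.
apply: (contains_embedding phi_inj) => x y.
by rewrite adj_ends E_adj !phiE (inj_eq phi_inj).
Qed.

(** Whether two edges meet does not depend on the other edges, so a copy of [F] that need not be
    induced still yields an induced copy of its line graph. *)
Lemma contains_line_graph (F : sgraph) (f : F -> root) :
    injective f -> (forall x y, adj x y -> adj (f x) (f y)) ->
  contains G (line_graph F).
Proof.
move=> f_inj f_adj.
apply: (@line_embedding (line_graph F) (fun e : line_graph F => f @: val e)).
- move=> e; have := valP e; rewrite inE => /existsP[x /existsP[y /andP[xy /eqP eE]]].
  exists (f x), (f y); split; first exact: f_adj.
  by rewrite eE imsetU !imset_set1.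
- by move=> e e' /(imset_inj f_inj)/val_inj.
move=> e e'; rewrite -imsetI; last by move=> x y _ _; apply: f_inj.
by rewrite imset_eq0.
Qed.

Lemma realises_d7_contains g : @realises root d7 g -> contains G B10.
Proof.
case=> g_inj g_adj.
(* This is the numbering of the vertices used in [d7]. *)
pose num (x : D7) : nat := match x with
  | Some (inl i) => i | Some (inr j) => 3 + j | None => 6 end.
have num_lt x : num x < 7.
  case: x => [[i|j]|] //=; first exact: leq_trans (ltn_ord i) _.
  by rewrite -[7]/(3 + 4) ltn_add2l (leq_trans (ltn_ord j)).
have num_inj : injective num.
  move=> [[i|i]|] [[j|j]|] //=.
  - by move/val_inj ->.
  - by move=> E; have := ltn_ord i; rewrite E.
  - by move=> E; have := ltn_ord i; rewrite E.
  - by move=> E; have := ltn_ord j; rewrite -E.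
  - by move=> [] /val_inj ->.
  - by move=> E; have := ltn_ord i; rewrite -(ltn_add2l 3) E.
  - by move=> E; have := ltn_ord j; rewrite -E.
  - by move=> E; have := ltn_ord j; rewrite -(ltn_add2l 3) -E.
apply: (@contains_line_graph D7 (fun x => g (num x))) => [x y|x y xy].
  by move/g_inj/num_inj; rewrite !inE /=; apply.
have : (num y \in nbrs d7 (num x)) || (num x \in nbrs d7 (num y)).
  move: x y xy =>
    [[[[|[|[|//]]] ?]|[[|[|[|//]]] ?]]|] [[[[|[|[|//]]] ?]|[[|[|[|//]]] ?]]|] //=;
  rewrite /= /del_edge_adj /= ?eq_set2 ?inE //=.
by case/orP=> /g_adj //; rewrite adj_sym.
Qed.

(* The edge set of S_{2,2,4} is indexed by the vertices of N_{1,1,3}: vertex p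
   of path t corresponds to the edge from leg t p to leg t p.+1. *)
Definition leg (t p : nat) : nat :=
  nth 0 (nth [::] [:: [:: 0; 1; 4]; [:: 0; 2; 5]; [:: 0; 3; 6; 7; 8]] t) p.

Lemma realises_spider_contains g :
  @realises root spider g -> contains G (generalised_net 1 1 3).
Proof.
case=> g_inj g_adj.
pose a x := leg x.1 x.2; pose b x := leg x.1 x.2.+1.
pose cells := [seq (t, p) | t <- iota 0 3, p <- iota 0 (nth 0 [:: 1; 1; 3] t).+1].
pose edge_ok x := [&& a x < 9, b x < 9 & b x \in nbrs spider (a x) ++
  [seq i <- iota 0 9 | a x \in nbrs spider i]].
pose same_ends x y := (a x == a y) && (b x == b y) || (a x == b y) && (b x == a y).
pose meet x y := [|| a x == a y, a x == b y, b x == a y | b x == b y].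
pose near (x y : nat * nat) := if x.1 == y.1 then (x.2.+1 == y.2) || (y.2.+1 == x.2)
  else (x.2 == 0) && (y.2 == 0).
(* Every cell gives an edge of the spider, distinct cells give distinct edges, and two edges meet
   exactly when the net prescribes it: eight cells, settled by evaluation. *)
have check : all (fun x => edge_ok x && all (fun y =>
    (same_ends x y ==> (x == y)) && (near x y == (x != y) && meet x y)) cells)
    cells by [].
pose cell (x : generalised_net 1 1 3) : nat * nat := (tag x : nat, tagged x : nat).
have cellP x : cell x \in cells.
  apply/allpairsPdep; exists (tag x : nat), (tagged x : nat).
  by split; rewrite // mem_iota ltn_ord.
have cell_inj : injective cell.
  by move=> [t p] [t' p'] [/val_inj E]; subst t' => /val_inj ->.
have g_eq i j : i < 9 -> j < 9 -> (g i == g j) = (i == j).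
  by move=> i9 j9; apply/eqP/eqP => [/g_inj|->] //; apply.
have cell_ok x : edge_ok (cell x) by have /allP/(_ _ (cellP x))/andP[] := check.
have cells_ok x y : (same_ends (cell x) (cell y) ==> (cell x == cell y)) &&
    (near (cell x) (cell y) == (cell x != cell y) && meet (cell x) (cell y)).
  by have /allP/(_ _ (cellP x))/andP[_ /allP/(_ _ (cellP y))] := check.
apply: (@line_embedding (generalised_net 1 1 3)
  (fun x => [set g (a (cell x)); g (b (cell x))])) => [x|x y|x y].
- exists (g (a (cell x))), (g (b (cell x))); split=> //.
  have /and3P[_ _] := cell_ok x; rewrite mem_cat mem_filter.
  by case/orP=> [/g_adj //|/andP[/g_adj]]; rewrite adj_sym.
- have [/and3P[ax bx _] /and3P[ay b_y _]] := (cell_ok x, cell_ok y).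
  move/eqP; rewrite eq_set2 !g_eq // => same.
  have /andP[/implyP/(_ same)/eqP/cell_inj //] := cells_ok x y.
have [/and3P[ax bx _] /and3P[ay b_y _]] := (cell_ok x, cell_ok y).
have /andP[_ /eqP nearE] := cells_ok x y.
rewrite -(inj_eq cell_inj) -[adj x y]/(near (cell x) (cell y)) nearE; congr (_ && _).
rewrite /meet -!g_eq //; apply/idP/set0Pn => [|[K]].
  case/or4P=> /eqP E; [exists (g (a (cell x)))|exists (g (a (cell x)))|
    exists (g (b (cell x)))|exists (g (b (cell x)))];
    by rewrite !inE ?eqxx ?E ?eqxx ?orbT.
rewrite !inE => /andP[/orP[]/eqP-> /orP[]->]; rewrite ?orbT //.
Qed.

(** The edges inside [X] form a nonempty union of components of [G] if [X] is nonempty. They are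
    coloured by [c], the other vertices by criticality, and together this would 3-colour [G]. *)
Lemma component_not_coloured (X : {set root}) c :
  edge_coloured_component X c -> X = set0.
Proof.
case=> X_closed c_sym c_proper; apply/eqP/negPn/negP=> /set0Pn[K0 K0X].
(* The pair picked may list the two ends in either order, which is harmless as [c] is symmetric. *)
pose col v := if [pick e : root * root | ends v == [set e.1; e.2]] is Some e
  then c e.1 e.2 else ord0.
have colE v K L : ends v = [set K; L] -> col v = c K L.
  rewrite /col => vE; case: pickP => [e /eqP|/(_ (K, L))]; last by rewrite vE eqxx.
  rewrite vE => /eqP; rewrite eq_set2.
  by case/orP=> /andP[/eqP-> /eqP->].
pose A := [set v | ends v \subset X].
have inA v (K : root) : v \in val K -> K \in X -> v \in A.
  move=> vK KX; have [L KL vE] := endsP vK.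
  by rewrite inE vE subUset !sub1set KX (X_closed _ _ KX KL).
have [|c0 c0_proper] := critical.2 (~: A).
  have /andP[K0_gt1 _] := root_card K0.
  have /card_gt0P[v vK0] := ltnW K0_gt1.
  by apply/eqP=> /setP/(_ v); rewrite in_setC in_setT (inA v K0).
have AP u v : u \in A -> adj u v -> v \in A.
  rewrite inE => /subsetP uX /root_of_edge[K uK vK].
  by apply: (inA v K vK); apply: uX; rewrite inE.
case: critical => ncol _; case: ncol.
exists (fun v => if v \in A then col v else c0 v) => u v uv.
case: (boolP (u \in A)) => uA; last first.
  have vA : v \notin A by apply: contra uA => vA; apply: AP vA _; rewrite adj_sym.
  by rewrite (negbTE vA); apply: c0_proper; rewrite ?inE //= inE in uA vA *.
rewrite (AP _ _ uA uv); have [K uK vK] := root_of_edge uv.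
have [[L KL uE] [M KM vE]] := (endsP uK, endsP vK).
rewrite (colE _ _ _ uE) (colE _ _ _ vE); apply: c_proper => //.
  by move: uA; rewrite inE => /subsetP; apply; rewrite inE.
apply: contraTneq uv => LM.
have -> : u = v by apply: ends_inj; rewrite uE vE LM.
by rewrite adj_irrefl.
Qed.

Lemma critical_contains_B10 :
  free (generalised_net 1 1 3) G -> contains G B10.
Proof.
(* A critical graph has a vertex, because the empty graph is 3-colourable; a clique through it is
   where the search starts. *)
move=> net_free; case: (pickP (predT : pred G)) => [v _|G0]; last first.
  by case: critical => ncol _; case: ncol; exists (fun=> ord0) => x; have := G0 x.
have /card_gt0P[K0 _] : 0 < #|ends v| by rewrite card_ends.
have [| | | | |[g /realises_d7_contains]|[X [c [/component_not_coloured->]]]] //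
  := @subcubic_search root _ _ _ _ _ K0.
- by move=> K; rewrite root_degree root_card.
- exact: root_triangle_free.
- exact: root_degree2_independent.
- exact: root_degree2_twin_free.
- by move=> g /realises_spider_contains.
by rewrite eqxx.
Qed.

End RootGraph.

(** * Reduction to vertex-critical induced subgraphs *)

Lemma critical_induced (G : sgraph) :
  colorable 3 G \/ exists S : {set G}, vertex_critical (induced S).
Proof.
pose properb (A : {set G}) (c : {ffun G -> 'I_3}) :=
  [forall x in A, forall y in A, adj x y ==> (c x != c y)].
have properP A (c : {ffun G -> 'I_3}) : reflect (proper_on c A) (properb A c).
  apply: (iffP forall_inP) => [cA x y xA yA xy|cA x xA].
    by have /forall_inP/(_ y yA)/implyP := cA x xA; apply.
  by apply/forall_inP=> y yA; apply/implyP; apply: cA.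
pose uncol A := ~~ [exists c, properb A c].
(* An inclusion-minimal vertex set that cannot be 3-coloured induces a critical graph. *)
have [/minset_exists[S /minsetP[S_uncol S_min] _]|colG] := boolP (uncol setT);
  last first.
  left; move: colG; rewrite negbK => /existsP[c /properP c_proper].
  by exists c => x y; apply: c_proper.
right; exists S; split=> [[c c_proper]|A A_proper].
  case/negP: S_uncol; apply/existsP.
  exists [ffun x => if insub x is Some u then c u else ord0].
  apply/properP=> x y xS yS xy; rewrite !ffunE !insubT.
  exact: c_proper.
have [|c_col] := boolP (uncol (val @: A)).
  have sub : val @: A \subset S by apply/subsetP=> _ /imsetP[u _ ->]; apply: valP.
  move=> /S_min/(_ sub) AE; case/eqP: A_proper; apply/setP=> u.
  have : val u \in val @: A by rewrite AE; apply: valP.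
  by rewrite inE mem_imset //; apply: val_inj.
move: c_col; rewrite negbK => /existsP[c /properP c_proper].
exists (fun u => c (val u)) => u v uA vA; apply: c_proper; exact: imset_f.
Qed.

Theorem theorem3 (G : sgraph) (Gconn : connected G)
    (Gclaw : free claw G) (Gdiamond : free diamond G)
    (Gnet : free (generalised_net 1 1 3) G) :
  contains G (complete 4) \/ contains G B10 \/ colorable 3 G.
Proof.
have [K4|K4_free] := contains_decidable G (complete 4); first by left.
right; have [colG|[S S_crit]] := critical_induced G; first by right.
have freeS F : free F G -> free F (induced S) by move=> F_free /contains_induced.
(* A copy of B_10 is found inside the critical subgraph on [S], which inherits all the forbidden
   subgraphs. *)
left; apply: (@contains_induced _ _ S).
by apply: critical_contains_B10; try exact: freeS.
Qed.
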